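(* Let $P$ be a poset on $[n]=\{1,\ldots,n\}$, and let $\mu_P$ be the number of heap-orderings of $P$, that is, the number of bijections $f:[n]\to[n]$ such that for all $x,y\in[n]$, $x\leq_Py\Rightarrow f(x)\leq f(y)$. Then $\lambda_P=\dfrac{\mu_P}{n!}$.
   Context: $\mathbb{K}$ is a field of characteristic zero. A quasi-poset is a pair $P=(A,\leq_P)$ with $A$ finite and $\leq_P$ reflexive and transitive (posets are particular quasi-posets); $x\sim_Py$ means $x\leq_Py$ and $y\leq_Px$; $cl(P)$ is the number of $\sim_P$-classes (the cardinality of $P$ if $P$ is a poset); $\lfloor P\rfloor$ is the isoclass; $P_{\mid B}$ is the restriction to $B\subseteq A$; $top(P)$ is the set of open sets, i.e. subsets $O$ with ($i\in O$, $i\leq_Pj$)$\Rightarrow j\in O$. $\mathcal{H}_{\mathbf{qp}}$ is the $\mathbb{K}$-vector space with basis the isoclasses of quasi-posets; it is a Hopf algebra with product $m$ given by disjoint union (unit: empty quasi-poset) and coproduct $\Delta(\lfloor P\rfloor)=\sum_{O\in top(P)}\lfloor P_{\mid A\setminus O}\rfloor\otimes\lfloor P_{\mid O}\rfloor$, graded by $cl$. $\mathbb{K}[X]$ is a graded Hopf algebra with its usual product and $\Delta(X)=X\otimes1+1\otimes X$. $\phi_0$ is the unique homogeneous (degree-preserving) Hopf algebra morphism $(\mathcal{H}_{\mathbf{qp}},m,\Delta)\to(\mathbb{K}[X],m,\Delta)$ sending, for every $n\ge1$, the isoclass of the quasi-poset with $n$ pairwise equivalent elements to $X$; $\lambda$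 is the unique character (algebra morphism to $\mathbb{K}$) of $\mathcal{H}_{\mathbf{qp}}$ with $\phi_0(\lfloor P\rfloor)=\lambda_PX^{cl(P)}$ for all quasi-posets $P$, where $\lambda_P=\lambda(\lfloor P\rfloor)$. *)

(* Defs.v *)
From HB Require Import structures.
From mathcomp Require Import all_boot all_order all_algebra all_fingroup.
From mathcomp Require Export generic_quotient finmap monalg.

Set Implicit Arguments.
Unset Strict Implicit.
Unset Printing Implicit Defensive.

Import GRing.Theory.
Local Open Scope ring_scope.
Local Open Scope quotient_scope.

(* The relation is stored as a set of pairs so that [qposet T] is a choiceType,
   which is needed to form the quotient [isoclass] below. *)
Definition qposet_axiom (T : finType) (G : {set T * T}) : bool :=
  [forall x, (x, x) \in G] &&
  [forall x, forall y, forall z,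
     ((x, y) \in G) ==> ((y, z) \in G) ==> ((x, z) \in G)].

Record qposet (T : finType) := QPoset {
  qgraph : {set T * T};
  _ : qposet_axiom qgraph
}.

HB.instance Definition _ (T : finType) := [isSub for @qgraph T].
HB.instance Definition _ (T : finType) := [Choice of qposet T by <:].

Definition qle (T : finType) (P : qposet T) : rel T :=
  fun x y => (x, y) \in qgraph P.

Lemma qle_refl T (P : qposet T) : reflexive (qle P).
Proof. by case: P => G GP x; have /andP[/forallP h _] := GP; apply: h. Qed.

Lemma qle_trans T (P : qposet T) : transitive (qle P).
Proof.
case: P => G GP y x z; rewrite /qle /= => xy yz.
have /andP[_ /forallP tr] := GP.
by have /forallP/(_ y)/forallP/(_ z) := tr x; rewrite xy yz.
Qed.

Fact qposet_of_subproof (T : finType) (r : rel T) :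
  reflexive r -> transitive r -> qposet_axiom [set u : T * T | r u.1 u.2].
Proof.
move=> rr rt; apply/andP; split; first by apply/forallP=> x; rewrite inE.
apply/forallP=> x; apply/forallP=> y; apply/forallP=> z; rewrite !inE /=.
by apply/implyP=> xy; apply/implyP=> /(rt _ _ _ xy).
Qed.

Definition qposet_of (T : finType) (r : rel T)
    (rr : reflexive r) (rt : transitive r) : qposet T :=
  QPoset (qposet_of_subproof rr rt).

Lemma qposet_ofE T r rr rt x y : qle (@qposet_of T r rr rt) x y = r x y.
Proof. by rewrite /qle inE. Qed.

Section Pullback.
Variables (T U : finType) (f : U -> T) (P : qposet T).

Fact qpull_refl : reflexive (fun x y => qle P (f x) (f y)).
Proof. by move=> x; apply: qle_refl. Qed.

Fact qpull_trans : transitive (fun x y => qle P (f x) (f y)).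
Proof. by move=> y x z; apply: qle_trans. Qed.

Definition qpull : qposet U := qposet_of qpull_refl qpull_trans.

Lemma qpullE x y : qle qpull x y = qle P (f x) (f y).
Proof. exact: qposet_ofE. Qed.
End Pullback.

Definition qrestr (T : finType) (P : qposet T) (B : {set T}) :
    qposet {x : T | x \in B} :=
  qpull (fun x : {x : T | x \in B} => val x) P.

Section DisjointUnion.
Variables (T U : finType) (P : qposet T) (Q : qposet U).

Definition qsum_rel (x y : T + U) : bool :=
  match x, y with
  | inl a, inl b => qle P a b
  | inr a, inr b => qle Q a b
  | _, _ => false
  end.

Fact qsum_refl : reflexive qsum_rel.
Proof. by case=> x; apply: qle_refl. Qed.

Fact qsum_trans : transitive qsum_rel.
Proof. by case=> [y|y] [x|x] [z|z] //=; apply: qle_trans. Qed.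

Definition qsum : qposet (T + U)%type := qposet_of qsum_refl qsum_trans.

Lemma qsumE x y : qle qsum x y = qsum_rel x y.
Proof. exact: qposet_ofE. Qed.
End DisjointUnion.

Fact qtotal_refl (T : finType) : reflexive (fun _ _ : T => true).
Proof. by []. Qed.
Fact qtotal_trans (T : finType) : transitive (fun _ _ : T => true).
Proof. by []. Qed.
(* all elements of T pairwise equivalent *)
Definition qtotal (T : finType) : qposet T :=
  qposet_of (@qtotal_refl T) (@qtotal_trans T).

Definition qempty : qposet void := qtotal void.

Definition qsim (T : finType) (P : qposet T) : rel T :=
  fun x y => qle P x y && qle P y x.

Definition cl (T : finType) (P : qposet T) : nat :=
  #|equivalence_partition (qsim P) [set: T]|.

Definition qopen (T : finType) (P : qposet T) (O : {set T}) : bool :=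
  [forall i in O, forall j, qle P i j ==> (j \in O)].

Definition qtop (T : finType) (P : qposet T) : {set {set T}} :=
  [set O : {set T} | qopen P O].

Definition qiso (T U : finType) (P : qposet T) (Q : qposet U) : bool :=
  [exists f : {ffun T -> U}, [&& injectiveb f, #|U| == #|T| &
     [forall x, forall y, qle P x y == qle Q (f x) (f y)]]].

Lemma qisoP (T U : finType) (P : qposet T) (Q : qposet U) :
  reflect (exists2 f : T -> U, bijective f &
             forall x y, qle P x y = qle Q (f x) (f y))
          (qiso P Q).
Proof.
apply: (iffP existsP) => [[f /and3P[/injectiveP fi /eqP c h]]|[f fb h]].
  exists f; first by apply: inj_card_bij fi _; rewrite c.
  by move=> x y; apply/eqP; move/forallP: h => /(_ x)/forallP/(_ y).
exists [ffun x => f x]; apply/and3P; split.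
- by apply/injectiveP=> x y; rewrite !ffunE => /(bij_inj fb).
- by rewrite (bij_eq_card fb).
- by apply/forallP=> x; apply/forallP=> y; rewrite !ffunE h.
Qed.

Lemma qiso_refl (T : finType) (P : qposet T) : qiso P P.
Proof. by apply/qisoP; exists id => //; exists id. Qed.

Lemma qiso_sym (T U : finType) (P : qposet T) (Q : qposet U) :
  qiso P Q -> qiso Q P.
Proof.
move=> /qisoP[f [g fK gK] h]; apply/qisoP; exists g; first by exists f.
by move=> x y; rewrite h !gK.
Qed.

Lemma qiso_trans (T U V : finType) (P : qposet T) (Q : qposet U)
    (R : qposet V) : qiso P Q -> qiso Q R -> qiso P R.
Proof.
move=> /qisoP[f fb hf] /qisoP[g gb hg]; apply/qisoP; exists (g \o f).
  exact: bij_comp.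
by move=> x y; rewrite hf hg.
Qed.

Lemma qiso_pull (T U : finType) (f : U -> T) (P : qposet T) :
  bijective f -> qiso (qpull f P) P.
Proof. by move=> fb; apply/qisoP; exists f => // x y; apply: qpullE. Qed.

Lemma qiso_sum (T U T' U' : finType) (P : qposet T) (Q : qposet U)
    (P' : qposet T') (Q' : qposet U') :
  qiso P P' -> qiso Q Q' -> qiso (qsum P Q) (qsum P' Q').
Proof.
move=> /qisoP[f [f' fK f'K] hf] /qisoP[g [g' gK g'K] hg]; apply/qisoP.
exists (fun x => match x with inl a => inl (f a) | inr b => inr (g b) end).
  exists (fun x => match x with inl a => inl (f' a) | inr b => inr (g' b) end);
    by case=> a; rewrite ?fK ?gK ?f'K ?g'K.
by case=> x [] y; rewrite !qsumE /= ?hf ?hg.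
Qed.

(* Every finite quasi-poset is isomorphic to one carried by some ['I_n]. *)
Definition oqposet : choiceType := {n : nat & qposet 'I_n}.

Definition oqiso (a b : oqposet) : bool := qiso (tagged a) (tagged b).

Fact oqiso_equiv : equiv_class_of oqiso.
Proof.
split=> [a|a b|b a c]; rewrite /oqiso; first exact: qiso_refl.
  by apply/idP/idP; apply: qiso_sym.
exact: qiso_trans.
Qed.

Canonical oqiso_equivrel := EquivRelPack oqiso_equiv.

Definition isoclass : Type := {eq_quot oqiso_equivrel}.
HB.instance Definition _ := Choice.on isoclass.
HB.instance Definition _ := EqQuotient.on isoclass.

Definition qord (T : finType) (P : qposet T) : oqposet :=
  Tagged (fun n => qposet 'I_n) (qpull (fun i : 'I_#|T| => enum_val i) P).

Definition isoc (T : finType) (P : qposet T) : isoclass := \pi_isoclass (qord P).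

Lemma qiso_qord (T : finType) (P : qposet T) : qiso (tagged (qord P)) P.
Proof. by apply: qiso_pull; apply: enum_val_bij. Qed.

Lemma isocP (T U : finType) (P : qposet T) (Q : qposet U) :
  reflect (isoc P = isoc Q) (qiso P Q).
Proof.
apply: (iffP idP) => [h|/eqmodP h].
  apply/eqmodP; apply: qiso_trans (qiso_qord P) _.
  by apply: qiso_trans h _; apply: qiso_sym; apply: qiso_qord.
apply: qiso_trans (qiso_sym (qiso_qord P)) _.
exact: qiso_trans h (qiso_qord Q).
Qed.

Definition irep (a : isoclass) : qposet 'I_(tag (repr a)) := tagged (repr a).

Lemma irepK (a : isoclass) : isoc (irep a) = a.
Proof.
rewrite -[RHS]reprK; apply/eqmodP; exact: qiso_qord.
Qed.

Lemma qiso_irep (T : finType) (P : qposet T) : qiso (irep (isoc P)) P.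
Proof. by apply/isocP; apply: irepK. Qed.

Definition icl (a : isoclass) : nat := cl (irep a).

Lemma cl_qiso (T U : finType) (P : qposet T) (Q : qposet U) :
  qiso P Q -> cl P = cl Q.
Proof.
move=> /qisoP[f fb h]; rewrite /cl.
have fi := bij_inj fb; have [g fK gK] := fb.
rewrite -(card_imset (mem (equivalence_partition (qsim P) [set: T]))
                     (imset_inj fi)).
congr #|pred_of_set _|; apply/setP=> B; apply/imsetP/imsetP.
  move=> [A /imsetP[x _ ->] ->]; exists (f x) => //.
  apply/setP=> y; rewrite !inE -[y]gK mem_imset // !inE /qsim !h //.
move=> [y _ ->]; exists [set x | qsim P (g y) x].
  by apply/imsetP; exists (g y) => //; apply/setP=> x; rewrite !inE.
by apply/setP=> z; rewrite !inE -[z]gK mem_imset // !inE /qsim !h !gK.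
Qed.

Lemma icl_isoc (T : finType) (P : qposet T) : icl (isoc P) = cl P.
Proof. exact: cl_qiso (qiso_irep P). Qed.

Definition iunion (a b : isoclass) : isoclass := isoc (qsum (irep a) (irep b)).
Definition iempty : isoclass := isoc qempty.

Lemma iunion_isoc (T U : finType) (P : qposet T) (Q : qposet U) :
  iunion (isoc P) (isoc Q) = isoc (qsum P Q).
Proof. by apply/isocP; apply: qiso_sum; apply: qiso_irep. Qed.

Fact iunionC : commutative iunion.
Proof.
move=> a b; rewrite -[a]irepK -[b]irepK !iunion_isoc; apply/isocP/qisoP.
pose s (A B : Type) (x : A + B) : B + A :=
  match x with inl u => inr u | inr u => inl u end.
by exists (@s _ _); [exists (@s _ _); case|case=> x [] y; rewrite !qsumE].
Qed.

Fact iunionA : associative iunion.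
Proof.
move=> a b c; rewrite -[a]irepK -[b]irepK -[c]irepK !iunion_isoc.
apply/isocP/qisoP.
pose s (A B C : Type) (x : A + (B + C)) : (A + B) + C :=
  match x with inl u => inl (inl u) | inr (inl u) => inl (inr u)
             | inr (inr u) => inr u end.
pose t (A B C : Type) (x : (A + B) + C) : A + (B + C) :=
  match x with inl (inl u) => inl u | inl (inr u) => inr (inl u)
             | inr u => inr (inr u) end.
exists (@s _ _ _); first by exists (@t _ _ _); [case=> [|[]]|case=> [[]|]].
by case=> [x|[x|x]] [y|[y|y]]; rewrite !qsumE /= ?qsumE.
Qed.

Fact iunion1m : left_id iempty iunion.
Proof.
move=> a; rewrite -[a]irepK iunion_isoc; apply/isocP/qisoP.
pose s (A : Type) (x : void + A) : A :=
  match x with inl u => of_void A u | inr u => u end.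
exists (@s _); first by exists inr => //; case=> [[]|].
by case=> [[]|x] [[]|y]; rewrite !qsumE.
Qed.

Fact iunionm1 : right_id iempty iunion.
Proof. by move=> a; rewrite iunionC iunion1m. Qed.

Lemma isoc_eq1 (T : finType) (P : qposet T) :
  (isoc P = iempty) <-> (#|T| = 0%N).
Proof.
split=> [/isocP/qisoP[f fb _]|T0]; first by rewrite (bij_eq_card fb) card_void.
have F (x : T) : False by move: (fintype0 x T0).
apply/isocP/qisoP; exists (fun x => False_rect _ (F x)).
  by exists (of_void T) => [x|[]]; case: (F x).
by move=> x; case: (F x).
Qed.

Fact iunion_eq1 a b : iunion a b = iempty -> a = iempty /\ b = iempty.
Proof.
rewrite -[a]irepK -[b]irepK iunion_isoc => /isoc_eq1; rewrite card_sum => /eqP.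
by rewrite addn_eq0 => /andP[/eqP h /eqP h']; split; apply/isoc_eq1.
Qed.

HB.instance Definition _ := Choice_isMonomialDef.Build isoclass
  iunionA iunion1m iunionm1 iunion_eq1.
HB.instance Definition _ := MonomialDef_isConomialDef.Build isoclass iunionC.

(* As an algebra, H_qp is the monoid algebra of the isoclasses: its product is
   disjoint union, its unit is the class of the empty quasi-poset. *)
Notation Hqp K := {malg K[isoclass]}.

(* H_qp (x) H_qp is modelled by the space with basis the pairs of isoclasses:
   [<< (a, b) >>] stands for a (x) b. *)
Notation Hqp2 K := {malg K[(isoclass * isoclass)%type]}.

Section Hopf.
Variable K : fieldType.

Definition qelt (T : finType) (P : qposet T) : Hqp K := << isoc P >>.

Definition qcoprod_basis (T : finType) (P : qposet T) : Hqp2 K :=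
  \sum_(O in qtop P) << (isoc (qrestr P (~: O)), isoc (qrestr P O)) >>.

(* The linear extension of [qcoprod_basis]; it does not depend on the chosen
   representatives, see [qcoprodE]. *)
Definition qcoprod (h : Hqp K) : Hqp2 K :=
  \sum_(a <- msupp h) h@_a *: qcoprod_basis (irep a).

Definition qcounit (h : Hqp K) : K := h@_iempty.

Definition qhomog (d : nat) (h : Hqp K) : Prop :=
  forall a : isoclass, a \in msupp h -> icl a = d.

Lemma qcoprod_basis_iso (T U : finType) (P : qposet T) (Q : qposet U) :
  qiso P Q -> qcoprod_basis P = qcoprod_basis Q.
Proof.
move=> /qisoP[f fb h]; have fi := bij_inj fb; have [g fK gK] := fb.
have R (A : {set T}) (B : {set U}) : (forall x, (f x \in B) = (x \in A)) ->
    isoc (qrestr P A) = isoc (qrestr Q B).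
  move=> AB; apply/isocP/qisoP.
  have F (x : {x | x \in A}) : f (val x) \in B by rewrite AB (valP x).
  have G (y : {y | y \in B}) : g (val y) \in A by rewrite -AB gK (valP y).
  exists (fun x => Sub (f (val x)) (F x)).
    by exists (fun y => Sub (g (val y)) (G y)) => x; apply: val_inj;
       rewrite !SubK ?fK ?gK.
  by move=> x y; rewrite !qpullE h.
rewrite /qcoprod_basis (reindex_onto (fun O : {set U} => f @^-1: O)
   (fun A : {set T} => f @: A)) /=; last first.
  by move=> A _; apply/setP=> x; rewrite inE mem_imset.
apply: eq_big => [O|O _]; last first.
  by congr << (_, _) >>; apply: R => x; rewrite !inE.
have -> : (f @: (f @^-1: O) == O) = true.
  by apply/eqP/setP=> y; rewrite -[y]gK mem_imset // inE.
rewrite andbT !inE; apply/forall_inP/forall_inP => H.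
  move=> i iO; apply/forallP=> j; apply/implyP=> ij.
  have := H (g i); rewrite inE gK => /(_ iO)/forallP/(_ (g j)).
  by rewrite h !gK inE gK ij.
move=> i; rewrite inE => iO; apply/forallP=> j; rewrite h inE.
by have /forallP/(_ (f j)) := H _ iO.
Qed.

Lemma qcoprodE (T : finType) (P : qposet T) :
  qcoprod (qelt P) = qcoprod_basis P.
Proof.
rewrite /qcoprod /qelt msuppU oner_eq0 big_seq_fset1 mcoeffUU scale1r.
exact: qcoprod_basis_iso (qiso_irep P).
Qed.

(* K[X] (x) K[X] is modelled by {poly {poly K}}, with X (x) 1 = 'X and
   1 (x) X = 'X%:P. *)
Definition ptens (p q : {poly K}) : {poly {poly K}} :=
  map_poly polyC p * q%:P.

Definition pcoprod (p : {poly K}) : {poly {poly K}} :=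
  (map_poly polyC p) \Po (ptens 'X 1 + ptens 1 'X).

Definition pcounit (p : {poly K}) : K := p.[0].

Definition phomog (d : nat) (p : {poly K}) : Prop :=
  exists c : K, p = c *: 'X^d.

(* phi (x) phi, read in the two models of tensor squares above *)
Definition tens_map (phi : Hqp K -> {poly K}) (z : Hqp2 K) : {poly {poly K}} :=
  \sum_(ab <- msupp z)
    ptens (z@_ab *: phi << ab.1 >>) (phi << ab.2 >>).

(* A bialgebra morphism between Hopf algebras commutes with the antipodes, so
   no condition on antipodes is needed. *)
Definition hopf_morphism (phi : {lrmorphism Hqp K -> {poly K}}) : Prop :=
  (forall h, pcounit (phi h) = qcounit h) /\
  (forall h, pcoprod (phi h) = tens_map phi (qcoprod h)).

Definition homogeneous (phi : Hqp K -> {poly K}) : Prop :=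
  forall d h, qhomog d h -> phomog d (phi h).

(* The conditions of which phi_0 is the unique solution; existence and
   uniqueness are not part of the definition. *)
Definition is_phi0 (phi : {lrmorphism Hqp K -> {poly K}}) : Prop :=
  [/\ hopf_morphism phi, homogeneous phi &
      forall n : nat, (0 < n)%N -> phi (qelt (qtotal 'I_n)) = 'X].

(* A character is a [{lrmorphism Hqp K -> K | *%R}]. *)
Definition is_lambda (phi : {lrmorphism Hqp K -> {poly K}})
    (lambda : {lrmorphism Hqp K -> K | *%R}) : Prop :=
  forall (T : finType) (P : qposet T),
    phi (qelt P) = lambda (qelt P) *: 'X^(cl P).

End Hopf.

Arguments qelt K {T} P.

Definition is_poset (T : finType) (P : qposet T) : Prop :=
  antisymmetric (qle P).

(* ['S_n] is the type of bijections of ['I_n]. *)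
Definition heap_orderings (n : nat) (P : qposet 'I_n) : {set 'S_n} :=
  [set f : 'S_n | [forall x, forall y, qle P x y ==> (f x <= f y)%N]].

Definition mu (n : nat) (P : qposet 'I_n) : nat := #|heap_orderings P|.

(* Main.v *)
Require Import Defs.
From mathcomp Require Import all_boot all_order all_algebra all_fingroup.

Set Implicit Arguments.
Unset Strict Implicit.
Unset Printing Implicit Defensive.

Import GRing.Theory.
Local Open Scope ring_scope.

(** Both sides satisfy the same recursion on the number of points, obtained by
deleting a maximal element.

Let P be a poset with m points, so that phi_0(P) = c_P X^m. Since phi_0 is a
coalgebra morphism,
  c_P (X (x) 1 + 1 (x) X)^m
    = sum over open O of c_(P minus O) c_(P restricted to O)
      X^(m - #|O|) (x) X^#|O|.
In the coefficient of X^(m - 1) (x) X the left side contributes m c_P, and the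
right side keeps the open sets with one point, which are the singletons of
maximal elements x; the factor c of a one-point poset is 1 because phi_0 sends
that poset to X. Hence m c_P is the sum, over the maximal x, of c_(P minus x)
([lam_rec]).

A heap-ordering of P takes its largest value at a maximal element x, and what
remains is an arbitrary heap-ordering of P minus x; so mu_P is the sum of the
mu_(P minus x) ([mu_rec]). Dividing by m! turns this into the recursion for
c_P, and both quantities are 1 on the empty poset. *)

(** * Maximal elements and restrictions of posets *)

Definition qmaximal (T : finType) (P : qposet T) (x : T) : bool :=
  [forall y, qle P x y ==> (y == x)].

Lemma qopen_set1 (T : finType) (P : qposet T) (x : T) :
  qopen P [set x] = qmaximal P x.
Proof.
apply/forall_inP/forallP => [/(_ x)|h _ /set1P-> ].
  by rewrite set11 => /(_ isT)/forallP h y; have:= h y; rewrite inE.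
by apply/forallP=> y; rewrite inE.
Qed.

Lemma cl_poset (T : finType) (P : qposet T) : is_poset P -> cl P = #|T|.
Proof.
move=> antiP; rewrite /cl /equivalence_partition -cardsT.
rewrite -(card_imset [set: T] (@set1_inj T)); congr #|pred_of_set _|.
apply: eq_imset => x; apply/setP => y; rewrite !inE /= eq_sym.
apply/idP/eqP => [/antiP // | ->]; by rewrite /qsim qle_refl.
Qed.

Lemma is_poset_pull (T U : finType) (f : U -> T) (P : qposet T) :
  injective f -> is_poset P -> is_poset (qpull f P).
Proof. by move=> fi antiP x y; rewrite !qpullE => /antiP/fi. Qed.

Lemma cl_qrestr_poset (T : finType) (P : qposet T) (B : {set T}) :
  is_poset P -> cl (qrestr P B) = #|B|.
Proof.
by move=> antiP; rewrite cl_poset ?card_sig //; apply: is_poset_pull val_inj _.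
Qed.

(** Deleting a point of ['I_n.+1] leaves a poset which can again be carried by
['I_n]; the induction on the number of points relies on this relabelling. *)
Lemma qiso_del n (P : qposet 'I_n.+1) (x : 'I_n.+1) :
  qiso (qrestr P (~: [set x])) (qpull (lift x) P).
Proof.
have liftP k : lift x k \in ~: [set x] by rewrite !inE eq_sym neq_lift.
apply/qiso_sym/qisoP; exists (fun k => Sub (lift x k) (liftP k)).
  apply: inj_card_bij => [k l /(congr1 val)/lift_inj //|].
  by rewrite card_sig cardsC1 !card_ord.
by move=> k l; rewrite !qpullE.
Qed.

(** * Heap-orderings *)

Section HeapOrderings.
Variables (n : nat) (P : qposet 'I_n.+1).

Lemma heapP (f : 'S_n.+1) :
  reflect (forall x y, qle P x y -> (f x <= f y)%N) (f \in heap_orderings P).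
Proof.
rewrite inE; apply: (iffP forallP) => h x; last first.
  by apply/forallP=> y; apply/implyP/h.
by move=> y; move: (h x) => /forallP/(_ y)/implyP.
Qed.

(** [lift_perm x ord_max s] is the ordering that puts [x] last and follows [s]
elsewhere, so the only constraints it adds to those on [s] are the relations
between [x] and the other points. *)
Lemma lift_perm_heap (x : 'I_n.+1) (s : 'S_n) :
  (lift_perm x ord_max s \in heap_orderings P) =
  qmaximal P x && (s \in heap_orderings (qpull (lift x) P)).
Proof.
apply/heapP/andP=> [h|[/forallP maxx]].
  split.
    apply/forallP=> y; apply/implyP=> /h; rewrite lift_perm_id.
    case: (unliftP x y) => [j ->|-> _]; last by rewrite eqxx.
    by rewrite lift_perm_lift lift_max leqNgt ltn_ord.
  rewrite inE; apply/forallP=> i; apply/forallP=> j; apply/implyP.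
  by rewrite qpullE => /h; rewrite !lift_perm_lift !lift_max.
rewrite inE => /forallP h y z.
case: (unliftP x z) => [k ->|->]; last by rewrite lift_perm_id leq_ord.
case: (unliftP x y) => [j ->|->]; last first.
  by move/(implyP (maxx _)); rewrite eq_sym (negPf (neq_lift x k)).
rewrite !lift_perm_lift !lift_max.
by have /forallP/(_ k)/implyP := h j; rewrite qpullE.
Qed.

Lemma lift_perm_inj (x y : 'I_n.+1) : injective (lift_perm x y).
Proof.
move=> s t e; apply/permP=> k; apply: (@lift_inj _ y).
by rewrite -!(lift_perm_lift x) e.
Qed.

Lemma lift_perm_onto (x : 'I_n.+1) (f : 'S_n.+1) :
  exists s, f = lift_perm x (f x) s.
Proof.
pose g k := odflt k (unlift (f x) (f (lift x k))).
have gK k : lift (f x) (g k) = f (lift x k).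
  have : f x != f (lift x k) by rewrite (inj_eq perm_inj) neq_lift.
  by rewrite /g => /unlift_some[j -> ->].
have g_inj : injective g.
  by move=> i j e; apply/(@lift_inj _ x)/(@perm_inj _ f); rewrite -!gK e.
exists (perm g_inj); apply/permP=> y.
case: (unliftP x y) => [j ->|->]; last by rewrite lift_perm_id.
by rewrite lift_perm_lift permE gK.
Qed.

(** The heap-orderings with largest value at [x] are the images under
[lift_perm x ord_max] of those of [P] minus [x], and exist only for maximal
[x]. *)
Lemma mu_rec :
  mu P = (\sum_(x | qmaximal P x) mu (qpull (lift x) P))%N.
Proof.
rewrite /mu -sum1_card.
rewrite (partition_big (fun f : 'S_n.+1 => (f^-1)%g ord_max) xpredT) //=.
rewrite [RHS]big_mkcond /=; apply: eq_bigr => x _; rewrite sum1dep_card.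
pose H := heap_orderings (qpull (lift x) P).
transitivity #|[set lift_perm x ord_max s | s in H & qmaximal P x]|; last first.
  rewrite card_imset; last exact: lift_perm_inj.
  case: ifP => _; last by apply: eq_card0 => s /[!inE] /[!andbF].
  by apply: eq_card => s /[!inE]; rewrite andbT.
congr #|pred_of_set _|; apply/setP=> f; rewrite inE.
apply/andP/imsetP => [[fH /eqP fx]|[s]].
  have fx_max : f x = ord_max by rewrite -fx permKV.
  have [s fE] := lift_perm_onto x f; rewrite fx_max in fE.
  by exists s => //; rewrite inE andbC -lift_perm_heap -fE.
rewrite inE => h ->; rewrite lift_perm_heap andbC h; split=> //.
by apply/eqP/(@perm_inj _ (lift_perm x ord_max s)); rewrite permKV lift_perm_id.
Qed.
End HeapOrderings.

(** * Coefficients in tensor squares *)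

Section TensorSquare.
Variable K : fieldType.

Lemma coef_ptens (p q : {poly K}) i j : (ptens p q)`_i`_j = p`_i * q`_j.
Proof. by rewrite /ptens coefMC coef_map coefCM. Qed.

Lemma pcoprod_Xn (c : K) m :
  pcoprod (c *: 'X^m) = c%:P *: ('X + 'X%:P) ^+ m.
Proof.
rewrite /pcoprod map_polyZ map_polyXn comp_polyZ comp_Xn_poly /ptens.
by rewrite map_polyX !rmorph1 mulr1 mul1r.
Qed.

(** The coefficient of X^(m - 1) (x) X. For [m = 0] the truncated predecessor
selects 1 (x) X instead, whose coefficient is 0 as well. *)
Lemma coef_pcoprod_Xn (c : K) m : (pcoprod (c *: 'X^m))`_m.-1`_1 = m%:R * c.
Proof.
rewrite pcoprod_Xn coefZ coefCM mulrC; congr (_ * _).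
case: m => [|m]; first by rewrite expr0 coef1 coef1.
(* only the binomial term of index 1 has degree 1 in 1 (x) X *)
rewrite exprDn !coef_sum big_ord_recl big_ord_recl /= big1 => [|i _].
  rewrite subn0 subn1 expr0 mulr1 bin0 bin1 expr1 /= !coefMn coefMC.
  by rewrite !coefXn ltn_eqF // eqxx mul1r coefX coef0 addr0 add0r.
by rewrite !coefMn -polyC_exp coefMC !coefXn mulr_natl coefMn coefXn !mul0rn.
Qed.

Lemma tens_map_sum (phi : {lrmorphism Hqp K -> {poly K}}) (I : finType)
    (A : pred I) (a b : I -> isoclass) :
  tens_map phi (\sum_(i in A) << (a i, b i) >>) =
  \sum_(i in A) ptens (phi << a i >>) (phi << b i >>).
Proof.
pose h ab : {poly {poly K}} := ptens (phi << ab.1 >>) (phi << ab.2 >>).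
pose f : {rmorphism K -> {poly {poly K}}} := polyC \o polyC.
(* additivity of [tens_map] is read off from that of [mmap] *)
have tensE z : tens_map phi z = mmap f h z.
  apply: eq_bigr => ab _.
  by rewrite /ptens map_polyZ /= -mul_polyC mulrA.
rewrite tensE raddf_sum; apply: eq_bigr => i _.
transitivity (f 1 * h (a i, b i)); first exact: mmapU.
by rewrite /= !polyC1 mul1r.
Qed.

End TensorSquare.

(** * The coefficients of phi_0 *)

(** The coefficient of [phi0] on [P] is kept as a variable [lam P]: with the
character in its place, rewriting would try to identify its values on different
quasi-posets by unfolding the monoid algebra. *)
Section LeadingCoefficient.
Variables (K : fieldType) (phi0 : {lrmorphism Hqp K -> {poly K}}).
Hypothesis phi0P : is_phi0 phi0.
Variable lam : forall T : finType, qposet T -> K.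
Hypothesis phi0E : forall (T : finType) (P : qposet T),
  phi0 (qelt K P) = lam P *: 'X^(cl P).

Lemma coef_phi0 (T : finType) (P : qposet T) i :
  (phi0 (qelt K P))`_i = lam P * (i == cl P)%:R.
Proof. by rewrite phi0E coefZ coefXn. Qed.

Lemma lam_iso (T U : finType) (P : qposet T) (Q : qposet U) :
  qiso P Q -> lam P = lam Q.
Proof.
move=> isoPQ; have := coef_phi0 P (cl P); have := coef_phi0 Q (cl P).
rewrite /qelt ((isocP P Q) isoPQ) (cl_qiso isoPQ) eqxx !mulr1.
by move=> <- <-.
Qed.

Lemma lam_empty (T : finType) (P : qposet T) : #|T| = 0%N -> lam P = 1.
Proof.
move=> T0.
have clP : cl P = 0%N by rewrite cl_poset // => x; have := fintype0 x T0.
have qP1 : qelt K P = 1 by rewrite /qelt ((isoc_eq1 P).2 T0).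
have phiP : phi0 (qelt K P) = 1 by rewrite qP1; apply: rmorph1.
by have := coef_phi0 P 0; rewrite phiP clP eqxx mulr1 coef1 => <-.
Qed.

Lemma lam_singleton (T : finType) (P : qposet T) : #|T| = 1%N -> lam P = 1.
Proof.
move=> T1; have [_ _ phi_total] := phi0P.
have -> : lam P = lam (qtotal 'I_1).
  have /fintype_le1P T_eq : (#|T| <= 1)%N by rewrite T1.
  apply/lam_iso/qisoP; exists (fun=> ord0).
    by apply: inj_card_bij; [move=> x y _; rewrite (T_eq y) | rewrite card_ord T1].
  by move=> x y; rewrite (T_eq y x) qle_refl qposet_ofE.
have := coef_phi0 (qtotal 'I_1) 1; rewrite phi_total // cl_poset ?card_ord.
  by rewrite coefX !eqxx mulr1 => <-.
by move=> x y _; rewrite !ord1.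
Qed.

Lemma coef_ptens_phi0 (T U : finType) (P : qposet T) (Q : qposet U) i j :
  (ptens (phi0 << isoc P >>) (phi0 << isoc Q >>))`_i`_j =
  lam P * (i == cl P)%:R * (lam Q * (j == cl Q)%:R).
Proof. by rewrite coef_ptens; congr (_ * _); apply: coef_phi0. Qed.

(** Comparing the coefficients of X^(m - 1) (x) X in the compatibility of
[phi0] with the coproducts leaves only the open sets with one point. *)
Lemma lam_rec (T : finType) (P : qposet T) : is_poset P ->
  #|T|%:R * lam P = \sum_(x | qmaximal P x) lam (qrestr P (~: [set x])).
Proof.
move=> antiP; have [[_ phi_coprod] _ _] := phi0P.
rewrite -coef_pcoprod_Xn -[X in 'X^X](cl_poset antiP) -phi0E.
rewrite phi_coprod qcoprodE /qcoprod_basis tens_map_sum !coef_sum.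
transitivity
    (\sum_(O in [set [set x] | x in qmaximal P]) lam (qrestr P (~: O))).
  rewrite [LHS](bigID (fun O : {set T} => #|O| == 1%N)) /= addrC big1 ?add0r.
    apply: eq_big => [O|O /andP[_ /eqP O1]].
      rewrite inE; apply/andP/imsetP => [[openO /cards1P[x Ox]]|[x maxx ->]].
        by exists x => //; rewrite -[_ \in _]/(qmaximal P x) -qopen_set1 -Ox.
      by rewrite qopen_set1 cards1.
    rewrite coef_ptens_phi0 !(cl_qrestr_poset _ antiP).
    rewrite (lam_singleton (qrestr P O)) ?card_sig // cardsCs setCK O1.
    by rewrite subn1 !eqxx !mulr1.
  move=> O /andP[_ O1]; rewrite coef_ptens_phi0.
  by rewrite (cl_qrestr_poset O antiP) (eq_sym 1%N) (negPf O1) !mulr0.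
by rewrite big_imset //= => x y _ _; apply: set1_inj.
Qed.

Lemma lam_poset (charK : [pchar K] =i pred0) n (P : qposet 'I_n) :
  is_poset P -> lam P = (mu P)%:R / (n`!)%:R.
Proof.
have nat_neq0 m : (0 < m)%N -> m%:R != 0 :> K.
  by rewrite ((pcharf0P K).1 charK) -lt0n.
elim: n P => [|n IHn] P antiP.
  rewrite lam_empty ?card_ord // fact0 divr1 /mu (_ : heap_orderings P = setT).
    by rewrite cardsT card_Sn.
  by apply/setP=> s; rewrite !inE; apply/forallP=> -[].
apply: (mulfI (nat_neq0 n.+1 isT)).
have := lam_rec antiP; rewrite card_ord => ->.
rewrite mu_rec natr_sum mulr_suml mulr_sumr; apply: eq_bigr => x _.
rewrite (lam_iso (qiso_del P x)) IHn; last exact: is_poset_pull lift_inj antiP.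
by rewrite factS natrM invfM mulrCA mulVKf ?nat_neq0.
Qed.
End LeadingCoefficient.

Theorem proposition32 (K : fieldType) (charK : [pchar K] =i pred0)
    (phi0 : {lrmorphism Hqp K -> {poly K}}) (phi0P : is_phi0 phi0)
    (lambda : {lrmorphism Hqp K -> K | *%R}) (lambdaP : is_lambda phi0 lambda)
    (n : nat) (P : qposet 'I_n) (posetP : is_poset P) :
  lambda (qelt K P) = (mu P)%:R / (n`!)%:R.
Proof.
exact: (lam_poset (lam := fun T Q => lambda (@qelt K T Q)) phi0P lambdaP charK).
Qed.
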